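(* Let $(\Theta,d_\Theta)$ be a totally bounded metric space, $(\mathcal{X},d_{\mathcal{X}})$ a metric space, and $(X_\theta)_{\theta\in\Theta}$ an $\mathcal{X}$-valued random process on a probability space $(\Omega,\mathcal{F},\mathbb{P})$. Assume: (i) $C,t>0$ are constants such that $N(\Theta,d_\Theta,\eta)\le C\eta^{-t}$ for all $\eta\in\,]0,\Delta(\Theta)]$; (ii) for all $(\theta,\vartheta)\in\Theta^2$ with $\theta\neq\vartheta$, the map $(X_\theta,X_\vartheta)$ is $\mathcal{F}|\mathcal{B}(\mathcal{X}^2)$-measurable; (iii) $M,p>0$ and $q>t$ are constants such that $\mathbb{E}[d_{\mathcal{X}}(X_\theta,X_\vartheta)^p]\le M\,d_\Theta(\theta,\vartheta)^q$ for all $\theta,\vartheta\in\Theta$. Let $\beta\in\,]0,(q-t)/p[$, and let $L(\Theta,C,t,M,p,q,\beta)$ be any constant such that, for every at most countable subset $\overline{\Theta}\subseteq\Theta$ with $\Delta(\overline{\Theta})>0$, $$\mathbb{E}\left[\sup_{\theta,\vartheta\in\overline{\Theta},\ \theta\neq\vartheta}\frac{d_{\mathcal{X}}(X_\theta,X_\vartheta)^p}{d_\Theta(\theta,\vartheta)^{\beta p}}\right]\le L(\Theta,C,t,M,p,q,\beta).$$ Then, for every at most countable subset $\overline{\Theta}\subseteq\Theta$ and arbitrary $\delta>0$, $$\mathbb{E}\left[\sup_{\theta,\vartheta\in\overline{\Theta},\ d_\Theta(\theta,\vartheta)\le\delta}d_{\mathcal{X}}(X_\theta,X_\vartheta)^p\right]\le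 L(\Theta,C,t,M,p,q,\beta)\,\delta^{\beta p}.$$
   Context: For $\overline{\Theta}\subseteq\Theta$, $\Delta(\overline{\Theta})$ is the diameter of $\overline{\Theta}$ w.r.t. $d_\Theta$, and $N(\overline{\Theta},d_\Theta,\eta)$ is the minimal number of closed $d_\Theta$-balls of radius $\eta>0$ with centers in $\overline{\Theta}$ needed to cover $\overline{\Theta}$. $\mathcal{B}(\cdot)$ denotes the Borel $\sigma$-algebra, and $\mathcal{X}^2$ carries the product topology. An $\mathcal{X}$-valued random process is a family $(X_\theta)_{\theta\in\Theta}$ of $\mathcal{F}|\mathcal{B}(\mathcal{X})$-measurable maps $X_\theta:\Omega\to\mathcal{X}$. $]a,b[$ denotes an open interval, $]a,b]$ a half-open one. *)

(* Defs.v *)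
From HB Require Import structures.
From mathcomp Require Import all_boot all_order all_algebra.
From mathcomp Require Import all_classical all_reals all_analysis.

Set Implicit Arguments.
Unset Strict Implicit.
Unset Printing Implicit Defensive.

Import Order.TTheory GRing.Theory Num.Theory.
Import numFieldNormedType.Exports.

Local Open Scope classical_set_scope.
Local Open Scope ring_scope.

(* Supremum in [0, +oo]: it agrees with [ereal_sup] on nonempty sets of
   nonnegative values, and is 0 (rather than -oo) on the empty set. *)
Definition nneg_sup (R : realType) (A : set (\bar R)) : \bar R :=
  maxe 0%E (ereal_sup A).

Definition diameter (R : realType) (T : metricType R) (A : set T) : \bar R :=
  nneg_sup [set (mdist x.1 x.2)%:E | x in A `*` A].

(* The library's [closed_ball] is the closure of the open ball, which in a
   general metric space may be smaller than this set. *)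
Definition closed_mball (R : realType) (T : metricType R) (x : T) (r : R) :
  set T := [set y | mdist x y <= r].

(* +oo when no finite cover exists. *)
Definition covering_number (R : realType) (T : metricType R) (A : set T)
    (eta : R) : \bar R :=
  ereal_inf [set n%:R%:E | n in
    [set n : nat | exists c : 'I_n -> T,
      (forall i, A (c i)) /\
      A `<=` \bigcup_(i in [set: 'I_n]) closed_mball (c i) eta]].

Definition totally_bounded (R : realType) (T : metricType R) (A : set T) :
    Prop :=
  forall e : R, 0 < e -> exists F : set T,
    [/\ finite_set F, F `<=` A & A `<=` \bigcup_(x in F) ball x e].

Definition borel (T : topologicalType) : set (set T) :=
  <<s [set U : set T | open U] >>.

(* [measurable_fun] into [g_sigma_algebraType open] would need [T] pointed. *)
Definition borel_measurable (d : measure_display) (Omega : measurableType d)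
    (T : topologicalType) (f : Omega -> T) : Prop :=
  forall B : set T, borel B -> measurable (f @^-1` B).

Definition random_process (d : measure_display) (Omega : measurableType d)
    (I : Type) (T : topologicalType) (X : I -> Omega -> T) : Prop :=
  forall i : I, borel_measurable (X i).

(* Main.v *)
Require Import Defs.
From HB Require Import structures.
From mathcomp Require Import all_boot all_order all_algebra.
From mathcomp Require Import all_classical all_reals all_analysis.

Import Order.TTheory GRing.Theory Num.Theory.
Import numFieldNormedType.Exports.

Local Open Scope classical_set_scope.
Local Open Scope ring_scope.

(** On the pairs [a != b] with [mdist a b <= delta], the numerator
    [mdist (X a w) (X b w) `^ p] is at most [delta `^ (beta * p)] times the
    Hoelder quotient, while on the diagonal it vanishes because [0 < p].  So,
    for each outcome, the supremum over [delta]-close pairs is at most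
    [delta `^ (beta * p)] times the supremum of the Hoelder quotients
    ([close_sup_le_quotient_sup]).  The bound passes to expectations because the
    integral of nonnegative functions is monotone and positively homogeneous
    ([ge0_integral_le_scale]).

    The assumed bound on the expected supremum of the quotients covers index
    sets of positive diameter.  A set of null diameter has no pair of distinct
    points ([diameter_gt0]); the supremum is then over the empty set, its
    expectation is [0], and the same bound holds since [0 <= L]. *)

Lemma nneg_sup_ge0 (R : realType) (A : set (\bar R)) : (0 <= nneg_sup A)%E.
Proof. by rewrite /nneg_sup le_max lexx. Qed.

Lemma nneg_sup_ubound (R : realType) (A : set (\bar R)) :
  ubound A (nneg_sup A).
Proof.
by move=> x Ax; rewrite /nneg_sup le_max ereal_sup_ubound ?orbT.
Qed.

Lemma ge_nneg_sup (R : realType) (A : set (\bar R)) (m : \bar R) :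
  (0 <= m)%E -> ubound A m -> (nneg_sup A <= m)%E.
Proof. by move=> m0 Am; rewrite /nneg_sup ge_max m0 ge_ereal_sup. Qed.

Lemma nneg_sup0 (R : realType) : nneg_sup set0 = 0%E :> \bar R.
Proof.
by apply/eqP; rewrite eq_le nneg_sup_ge0 andbT ge_nneg_sup.
Qed.

Lemma diameter_gt0 (R : realType) (T : metricType R) (A : set T) (a b : T) :
  A a -> A b -> a != b -> (0 < diameter A)%E.
Proof.
move=> Aa Ab ab; apply: (@lt_le_trans _ _ (mdist a b)%:E).
  by rewrite lte_fin mdist_gt0.
by apply: nneg_sup_ubound; exists (a, b).
Qed.

(** The integral of a nonnegative function is the supremum of the integrals of
    the simple functions below it, and dividing by [c] turns a simple function
    below [f] into one below [g].  Arguing at this level makes monotonicity and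
    homogeneity available for arbitrary nonnegative [f] and [g]. *)
Lemma ge0_integral_le_scale (d : measure_display) (T : measurableType d)
    (R : realType) (mu : {measure set T -> \bar R}) (c : R)
    (f g : T -> \bar R) :
  0 < c -> (forall x, 0 <= f x)%E -> (forall x, 0 <= g x)%E ->
  (forall x, f x <= c%:E * g x)%E ->
  (\int[mu]_x f x <= c%:E * \int[mu]_x g x)%E.
Proof.
move=> c0 f0 g0 fg; rewrite !ge0_integralTE//.
apply: ge_ereal_sup => _ [h hf <-].
have ci0 : 0 <= c^-1 by rewrite invr_ge0 ltW.
rewrite -lee_pdivrMl// -sintegralrM.
apply: ereal_sup_ubound; exists (scale_nnsfun h ci0) => //= x.
by rewrite EFinM lee_pdivrMl// (le_trans (hf x)).
Qed.

(** A pair with [a = b], absent from the index set on the right, contributes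
    only [0 `^ p = 0] on the left.  For [a != b] the numerator is the quotient
    times [mdist a b `^ r], and that factor is at most [delta `^ r]. *)
Lemma close_sup_le_quotient_sup (R : realType) (T S : metricType R)
    (x : T -> S) (B : set T) (p r delta : R) :
  0 < p -> 0 <= r -> 0 < delta ->
  (nneg_sup
     [set (mdist (x y.1) (x y.2) `^ p)%:E
      | y in [set y : T * T | [/\ B y.1, B y.2 & (mdist y.1 y.2 <= delta)%R]]]
   <= (delta `^ r)%:E *
      nneg_sup
        [set (mdist (x y.1) (x y.2) `^ p / mdist y.1 y.2 `^ r)%:E
         | y in [set y : T * T | [/\ B y.1, B y.2 & y.1 != y.2]]])%E.
Proof.
move=> p0 r0 delta0.
have bound_ge0 (A : set (\bar R)) : (0 <= (delta `^ r)%:E * nneg_sup A)%E.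
  by rewrite mule_ge0 ?lee_fin ?powR_ge0 ?nneg_sup_ge0.
apply: ge_nneg_sup => // _ [[a b] /= [Ba Bb abd] <-].
have [->|ab] := eqVneq a b; first by rewrite mdistxx powR0 ?gt_eqF.
have dist_gt0 : 0 < mdist a b `^ r by rewrite powR_gt0 ?mdist_gt0.
set s := nneg_sup _.
have quotient_le : ((mdist (x a) (x b) `^ p / mdist a b `^ r)%:E <= s)%E.
  by apply: nneg_sup_ubound; exists (a, b).
apply: (@le_trans _ _ ((delta `^ r)%:E *
    (mdist (x a) (x b) `^ p / mdist a b `^ r)%:E)%E); last first.
  by rewrite lee_wpmul2l ?lee_fin ?powR_ge0.
rewrite -EFinM lee_fin mulrCA ler_peMr ?powR_ge0// ler_pdivlMr// mul1r.
by rewrite ge0_ler_powR// nnegrE ?mdist_ge0 ?ltW.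
Qed.

Theorem corollary1p1 (R : realType)
    (Theta : metricType R) (S : metricType R)
    (d : measure_display) (Omega : measurableType d) (P : probability Omega R)
    (X : Theta -> Omega -> S)
    (Theta_tb : totally_bounded [set: Theta])
    (X_process : random_process X)
    (C t : R) (C_gt0 : 0 < C) (t_gt0 : 0 < t)
    (covering : forall eta : R, 0 < eta ->
      (eta%:E <= diameter [set: Theta])%E ->
      (covering_number [set: Theta] eta <= (C * eta `^ (- t))%:E)%E)
    (X_pair : forall a b : Theta, a != b ->
      borel_measurable (fun w => (X a w, X b w) : (S * S)%type))
    (M p q : R) (M_gt0 : 0 < M) (p_gt0 : 0 < p) (t_lt_q : t < q)
    (moment : forall a b : Theta,
      ('E_P[(fun w => mdist (X a w) (X b w) `^ p)%R]
        <= (M * mdist a b `^ q)%:E)%E)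
    (beta : R) (beta_gt0 : 0 < beta) (beta_lt : beta < (q - t) / p)
    (L : R) (L_ge0 : 0 <= L)
    (L_bound : forall B : set Theta, countable B -> (0 < diameter B)%E ->
      (\int[P]_w nneg_sup
         [set (mdist (X x.1 w) (X x.2 w) `^ p
                 / mdist x.1 x.2 `^ (beta * p))%:E
          | x in [set x : Theta * Theta | [/\ B x.1, B x.2 & x.1 != x.2]]]
        <= L%:E)%E) :
  forall (B : set Theta) (delta : R), countable B -> 0 < delta ->
    (\int[P]_w nneg_sup
       [set (mdist (X x.1 w) (X x.2 w) `^ p)%:E
        | x in [set x : Theta * Theta |
                 [/\ B x.1, B x.2 & (mdist x.1 x.2 <= delta)%R]]]
      <= (L * delta `^ (beta * p))%:E)%E.
Proof.
move=> B delta Bcount delta0.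
set quotients := fun w => [set (mdist (X x.1 w) (X x.2 w) `^ p
                 / mdist x.1 x.2 `^ (beta * p))%:E
          | x in [set x : Theta * Theta | [/\ B x.1, B x.2 & x.1 != x.2]]].
have quotient_bound : (\int[P]_w nneg_sup (quotients w) <= L%:E)%E.
  have [/L_bound|diamB] := boolP (0 < diameter B)%E; first exact.
  have quotients0 w : quotients w = set0.
    apply/seteqP; split=> // _ [[a b] /= [Ba Bb ab] _].
    by move/negP: diamB; apply; exact: diameter_gt0 Ba Bb ab.
  under eq_integral do rewrite quotients0 nneg_sup0.
  by rewrite integral0 lee_fin.
apply: (@le_trans _ _ ((delta `^ (beta * p))%:E *
    \int[P]_w nneg_sup (quotients w))%E).
  apply: ge0_integral_le_scale => [|w|w|w]; rewrite ?powR_gt0 ?nneg_sup_ge0//.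
  apply: (close_sup_le_quotient_sup _ _ _ (fun a => X a w)) => //.
  by rewrite mulr_ge0 ?ltW.
by rewrite (mulrC L) EFinM lee_wpmul2l ?lee_fin ?powR_ge0.
Qed.
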